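(* Let $\mathcal{H}$ be a finite-dimensional Hilbert space and $\tau$ a quantum channel on $\mathcal{H}$ having a faithful (full-rank) fixed point $\rho_*\in\mathcal{S}(\mathcal{H})$. Then $\tau$ is mixing if and only if the function $S:\mathcal{S}(\mathcal{H})\to\mathbb{R}$, $S(\rho)=H(\rho,\rho_* )\equiv\mathrm{Tr}\,\rho(\log\rho-\log\rho_* )$, is a generalised Lyapunov function for $\tau$ around $\rho_*$.
   Context: $\mathcal{S}(\mathcal{H})$ is the set of density matrices on $\mathcal{H}$ with the trace-norm topology. A quantum channel is a linear, completely positive, trace-preserving map on the operators of $\mathcal{H}$, considered as a map $\mathcal{S}(\mathcal{H})\to\mathcal{S}(\mathcal{H})$. $\tau$ is mixing if there is $\rho_0\in\mathcal{S}(\mathcal{H})$ with $\tau^n(\rho)\to\rho_0$ for all $\rho\in\mathcal{S}(\mathcal{H})$. A continuous $S:\mathcal{S}(\mathcal{H})\to\mathbb{R}$ is a generalised Lyapunov function for $\tau$ around $\rho_*$ if for each $\rho$ the sequence $S(\tau^n(\rho))$ converges and $\lim_n S(\tau^n(\rho))\neq S(\rho)$ for all $\rho\neq\rho_*$. The convention $0\log0=0$ is used. *)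

(* Defs.v *)
(* R : realType (mathcomp-analysis), C := R[i] (real_closed complex). *)
From HB Require Import structures.
From mathcomp Require Import all_boot all_order all_algebra.
From mathcomp Require Import all_classical all_reals.
From mathcomp Require Import exp sequences topology normedtype.
From mathcomp Require Import complex mxtens.

Set Implicit Arguments.
Unset Strict Implicit.
Unset Printing Implicit Defensive.

Import Order.TTheory GRing.Theory Num.Theory numFieldNormedType.Exports.
Local Open Scope ring_scope.
Local Open Scope complex_scope.
Local Open Scope classical_set_scope.

Section QDefs.
Variable R : realType.
Local Notation C := R[i].

(* Hermitian adjoint A^dagger *)
Definition mxadj {m n : nat} (A : 'M[C]_(m, n)) : 'M[C]_(n, m) :=
  (map_mx (fun z : C => z^*) A)^T.

Definition unitary_mx {n : nat} (U : 'M[C]_n) : Prop := mxadj U *m U = 1%:M.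

(* positive semidefinite: Hermitian and <v, A v> >= 0 for all v *)
Definition psd_mx {n : nat} (A : 'M[C]_n) : Prop :=
  mxadj A = A /\ forall v : 'cV[C]_n, 0 <= (mxadj v *m A *m v) 0 0.

(* density matrices S(H), H = C^n *)
Definition density {n : nat} (rho : 'M[C]_n) : Prop :=
  psd_mx rho /\ \tr rho = 1.

(* A = U diag(d) U^dagger with U unitary and d real *)
Definition spectral_dec {n : nat} (A : 'M[C]_n) (Ud : 'M[C]_n * 'rV[R]_n) : Prop :=
  unitary_mx Ud.1 /\
  A = Ud.1 *m diag_mx (map_mx (fun x : R => x%:C) Ud.2) *m mxadj Ud.1.

(* functional calculus f(A) for a Hermitian matrix A (via a chosen
   spectral decomposition; independent of the choice); 0 if A admits none *)
Definition mxfun {n : nat} (f : R -> R) (A : 'M[C]_n) : 'M[C]_n :=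
  match pselect (exists Ud, spectral_dec A Ud) with
  | left H => let Ud := projT1 (cid H) in
      Ud.1 *m diag_mx (map_mx (fun x : R => (f x)%:C) Ud.2) *m mxadj Ud.1
  | right _ => 0
  end.

(* natural logarithm, extended by 0 on (-oo,0]; this realises 0 log 0 = 0 *)
Definition log0 (x : R) : R := if 0 < x then ln x else 0.

Definition mxlog {n : nat} (A : 'M[C]_n) : 'M[C]_n := mxfun log0 A.

(* trace norm ||A||_1 = Tr sqrt(A^dagger A) *)
Definition trnorm {n : nat} (A : 'M[C]_n) : R :=
  complex.Re (\tr (mxfun (@Num.sqrt R) (mxadj A *m A))).

(* relative entropy H(rho, sigma) = Tr rho (log rho - log sigma) (real part) *)
Definition rel_entropy {n : nat} (rho sigma : 'M[C]_n) : R :=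
  complex.Re (\tr (rho *m (mxlog rho - mxlog sigma))).

(* (id_k (x) tau) acting on 'M_(k*n) = M_k (x) M_n *)
Definition ampl {n : nat} (k : nat) (tau : 'M[C]_n -> 'M[C]_n)
  (X : 'M[C]_(k * n)) : 'M[C]_(k * n) :=
  \matrix_(p, q)
    tau (\matrix_(a, b) X (mxtens_index ((mxtens_unindex p).1, a))
                          (mxtens_index ((mxtens_unindex q).1, b)))
        (mxtens_unindex p).2 (mxtens_unindex q).2.

Definition quantum_channel {n : nat} (tau : 'M[C]_n -> 'M[C]_n) : Prop :=
  [/\ (forall (a : C) (A B : 'M[C]_n), tau (a *: A + B) = a *: tau A + tau B),
      (forall (k : nat) (X : 'M[C]_(k * n)), psd_mx X -> psd_mx (@ampl n k tau X))
    & (forall A : 'M[C]_n, \tr (tau A) = \tr A)].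

Definition mixing {n : nat} (tau : 'M[C]_n -> 'M[C]_n) : Prop :=
  exists rho0 : 'M[C]_n, density rho0 /\
    forall rho, density rho ->
      (fun m : nat => trnorm (iter m tau rho - rho0)) @ \oo --> (0 : R).

(* continuity on S(H) for the trace-norm topology *)
Definition continuous_on_states {n : nat} (S : 'M[C]_n -> R) : Prop :=
  forall rho, density rho -> forall e : R, 0 < e -> exists2 d : R, 0 < d &
    forall sigma, density sigma -> trnorm (sigma - rho) < d -> `|S sigma - S rho| < e.

Definition gen_lyapunov {n : nat} (S : 'M[C]_n -> R)
  (tau : 'M[C]_n -> 'M[C]_n) (rhos : 'M[C]_n) : Prop :=
  [/\ continuous_on_states S,
      (forall rho, density rho -> cvgn (fun m : nat => S (iter m tau rho)))
    & (forall rho, density rho -> rho <> rhos ->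
         limn (fun m : nat => S (iter m tau rho)) <> S rho)].

End QDefs.

(* Main.v *)
(* Klein's inequality makes the relative entropy S(rho) = H(rho, rhos) strictly positive away from rhos, where it vanishes, and S is continuous; so if tau is mixing, S(tau^m rho) tends to 0, which differs from S(rho) unless rho = rhos. No monotonicity of the relative entropy under channels is involved.

   Conversely, if some orbit does not converge to rhos, compactness of the set of states gives a limit point L <> rhos of that orbit. By continuity S takes the value lim S(tau^m rho) on the whole orbit of L, so S(tau^k L) is constant in k, contradicting the Lyapunov property at L.

   Spectral computations use the weights w_ij = |<u_i, v_j>|^2 of two orthonormal bases. They are doubly stochastic, and with spectra p and q of rho and sigma, both H(rho, sigma) = \sum w_ij p_i (log p_i - log q_j) and ||rho - sigma||_2^2 = \sum w_ij (p_i - q_j)^2 are averages of scalar expressions. *)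
Require Import Defs.
From HB Require Import structures.
From mathcomp Require Import all_boot all_order all_algebra.
From mathcomp Require Import all_classical all_reals.
From mathcomp Require Import exp sequences topology normedtype.
From mathcomp Require Import complex mxtens.
From mathcomp Require Import spectral sesquilinear ring lra.

Set Implicit Arguments.
Unset Strict Implicit.
Unset Printing Implicit Defensive.

Import Order.TTheory GRing.Theory Num.Theory.
Import numFieldNormedType.Exports.
Local Open Scope ring_scope.
Local Open Scope complex_scope.

Section RelativeEntropy.
Variable R : realType.
Local Notation C := R[i].
Local Notation normc := (@ComplexField.Normc.normc R).
Local Open Scope classical_set_scope.

(** * Spectral decompositions *)

Lemma mxadjE m n (A : 'M[C]_(m, n)) i j : mxadj A i j = (A j i)^*%C.
Proof. by rewrite !mxE. Qed.

Lemma mxadjM m n p (A : 'M[C]_(m, n)) (B : 'M[C]_(n, p)) :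
  mxadj (A *m B) = mxadj B *m mxadj A.
Proof. by rewrite /mxadj map_mxM trmx_mul. Qed.

Lemma mxadjB m n (A B : 'M[C]_(m, n)) : mxadj (A - B) = mxadj A - mxadj B.
Proof. by rewrite /mxadj map_mxB linearB. Qed.

Lemma mxadjK m n (A : 'M[C]_(m, n)) : mxadj (mxadj A) = A.
Proof. by apply/matrixP=> i j; rewrite !mxadjE conjcK. Qed.

Lemma mxadj_trmxC m n (A : 'M[C]_(m, n)) : mxadj A = map_mx Num.conj A^T.
Proof. by apply/matrixP=> i j; rewrite !mxE. Qed.

Definition rdiag n (d : 'rV[R]_n) : 'M[C]_n :=
  diag_mx (map_mx (fun x : R => x%:C) d).

Lemma mxadj_rdiag n (d : 'rV[R]_n) : mxadj (rdiag d) = rdiag d.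
Proof.
apply/matrixP=> i j; rewrite mxadjE !mxE.
by case: eqVneq => [->|ji]; rewrite ?eqxx ?mulr1n ?conjc_real.
Qed.

Lemma unitary_mxC n (U : 'M[C]_n) : unitary_mx U -> U *m mxadj U = 1%:M.
Proof. exact: mulmx1C. Qed.

(** The spectral theorem writes a normal matrix as V^-1 D V with V unitary; taking real parts of D
    loses nothing, since a Hermitian matrix has real eigenvalues. *)
Lemma hermitian_spectral_dec n (A : 'M[C]_n) :
  mxadj A = A -> exists Ud, spectral_dec A Ud.
Proof.
move=> hA.
have hH : A \is hermsymmx.
  by apply/is_hermitianmxP; rewrite expr0 scale1r -{1}hA mxadj_trmxC.
have nA := hermitian_normalmx hH.
have uV := spectral_unitarymx A.
set V := spectralmx A in uV.
have vv : V *m mxadj V = 1%:M by rewrite mxadj_trmxC; apply/unitarymxP.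
exists (mxadj V, \row_j complex.Re (spectral_diag A 0 j)); split=> /=.
  by rewrite /unitary_mx mxadjK.
rewrite {1}(orthomx_spectralP nA) invmx_unitary // -mxadj_trmxC mxadjK.
congr (_ *m diag_mx _ *m _); apply/rowP=> j; rewrite !mxE.
by rewrite RRe_real //; apply: (mxOverP (hermitian_spectral_diag_real hH)).
Qed.

(* The choice made by [mxfun] matters only up to this lemma: it exposes one spectral decomposition of [A] in which [f(A)] is diagonal too. *)
Lemma mxfun_spectral n (f : R -> R) (A : 'M[C]_n) : mxadj A = A ->
  exists U (d : 'rV[R]_n), [/\ unitary_mx U, A = U *m rdiag d *m mxadj U &
    mxfun f A = U *m rdiag (map_mx f d) *m mxadj U].
Proof.
move=> /hermitian_spectral_dec hA; rewrite /mxfun; case: pselect => // H.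
case: (cid H) => Ud [uU AE]; exists Ud.1, Ud.2; split; [exact: uU|exact: AE|].
rewrite -[projT1 _]/Ud /rdiag.
suff -> : map_mx (fun x : R => x%:C) (map_mx f Ud.2) =
          map_mx (fun x : R => (f x)%:C) Ud.2 by [].
by apply/rowP=> j; rewrite !mxE.
Qed.

Lemma mxtrace_unitary n (U A : 'M[C]_n) : unitary_mx U ->
  \tr (U *m A *m mxadj U) = \tr A.
Proof. by move=> uU; rewrite mxtrace_mulC mulmxA uU mul1mx. Qed.

Lemma mxtrace_rdiag n (d : 'rV[R]_n) : \tr (rdiag d) = (\sum_i d 0 i)%:C.
Proof.
by rewrite mxtrace_diag rmorph_sum; apply: eq_bigr=> i _; rewrite mxE.
Qed.

Lemma spectralM n (U : 'M[C]_n) (d e : 'rV[R]_n) : unitary_mx U ->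
  (U *m rdiag d *m mxadj U) *m (U *m rdiag e *m mxadj U) =
  U *m rdiag (\row_i (d 0 i * e 0 i)) *m mxadj U.
Proof.
move=> uU; rewrite !mulmxA -[_ *m mxadj U *m U]mulmxA uU mulmx1.
rewrite -[U *m _ *m rdiag e]mulmxA mulmx_diag; congr (_ *m diag_mx _ *m _).
by apply/rowP=> j; rewrite !mxE rmorphM.
Qed.

(** * Overlap weights and the squared Frobenius norm *)

Definition normc2 (z : C) : R := complex.Re z ^+ 2 + complex.Im z ^+ 2.

Lemma mulJc (z : C) : z^*%C * z = (normc2 z)%:C.
Proof. by case: z => a b; rewrite /normc2; simpc => /=; congr (_ +i* _); ring. Qed.

Lemma mulcJ (z : C) : z * z^*%C = (normc2 z)%:C.
Proof. by rewrite mulrC mulJc. Qed.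

Lemma normc2_ge0 z : 0 <= normc2 z.
Proof. by rewrite addr_ge0 ?sqr_ge0. Qed.

Lemma normc2_eq0 z : normc2 z = 0 -> z = 0.
Proof.
case: z => a b /eqP; rewrite paddr_eq0 ?sqr_ge0 // !sqrf_eq0 /=.
by move=> /andP[/eqP-> /eqP->].
Qed.

Definition overlap n (U V : 'M[C]_n) i j : R := normc2 ((mxadj U *m V) i j).

Lemma overlap_ge0 n (U V : 'M[C]_n) i j : 0 <= overlap U V i j.
Proof. exact: normc2_ge0. Qed.

Lemma overlap_row n (U V : 'M[C]_n) i : unitary_mx U -> unitary_mx V ->
  \sum_j overlap U V i j = 1.
Proof.
move=> uU uV; apply: (@complexI R); rewrite rmorph_sum /=.
have : (mxadj U *m V *m mxadj (mxadj U *m V)) i i = 1.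
  by rewrite mxadjM mxadjK mulmxA -(mulmxA _ V) unitary_mxC // mulmx1 uU mxE eqxx.
rewrite rmorph1 => <-; rewrite mxE; apply: eq_bigr => j _.
by rewrite mxadjE mulcJ.
Qed.

Lemma overlap_col n (U V : 'M[C]_n) j : unitary_mx U -> unitary_mx V ->
  \sum_i overlap U V i j = 1.
Proof.
move=> uU uV; apply: (@complexI R); rewrite rmorph_sum /=.
have : (mxadj (mxadj U *m V) *m (mxadj U *m V)) j j = 1.
  by rewrite mxadjM mxadjK mulmxA -(mulmxA _ U) unitary_mxC // mulmx1 uV mxE eqxx.
rewrite rmorph1 => <-; rewrite mxE; apply: eq_bigr => i _.
by rewrite mxadjE mulJc.
Qed.

(** By cyclicity the trace is Tr D M E M^dagger with M = U^dagger V, whose expansion only involves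
    |M_ij|^2. *)
Lemma mxtrace_spectral2 n (U V : 'M[C]_n) (d e : 'rV[R]_n) :
  \tr ((U *m rdiag d *m mxadj U) *m (V *m rdiag e *m mxadj V)) =
  (\sum_i \sum_j overlap U V i j * (d 0 i * e 0 j))%:C.
Proof.
rewrite -!mulmxA mxtrace_mulC -!mulmxA.
set M := mxadj U *m V.
have -> : mxadj V *m U = mxadj M by rewrite mxadjM mxadjK.
rewrite (mulmxA (mxadj U)) -/M (mulmxA M) /mxtrace rmorph_sum.
apply: eq_bigr => i _ /=; rewrite mul_diag_mx mxE rmorph_sum.
rewrite [X in _ * X]mxE mulr_sumr; apply: eq_bigr => j _ /=.
have -> : overlap U V i j = normc2 (M i j) by [].
(* [M] loses its body here, so that [mxE] stops at its entries. *)
rewrite mul_mx_diag mxadjE; move: M => M; rewrite !mxE !rmorphM /= -mulcJ; ring.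
Qed.

Definition fnorm2 n (A : 'M[C]_n) : R := \sum_i \sum_j normc2 (A i j).

Lemma mxtrace_adjM n (A : 'M[C]_n) : \tr (mxadj A *m A) = (fnorm2 A)%:C.
Proof.
rewrite /fnorm2 exchange_big rmorph_sum; apply: eq_bigr => j _.
rewrite mxE rmorph_sum; apply: eq_bigr => i _ /=.
by rewrite mxadjE mulJc.
Qed.

Lemma fnorm2_ge0 n (A : 'M[C]_n) : 0 <= fnorm2 A.
Proof. by apply: sumr_ge0 => i _; apply: sumr_ge0 => j _; apply: normc2_ge0. Qed.

Lemma normc2_le_fnorm2 n (A : 'M[C]_n) i j : normc2 (A i j) <= fnorm2 A.
Proof.
rewrite /fnorm2 (bigD1 i) //= (bigD1 j) //= -addrA lerDl addr_ge0 //.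
  by apply: sumr_ge0 => k _; apply: normc2_ge0.
by apply: sumr_ge0 => k _; apply: sumr_ge0 => l _; apply: normc2_ge0.
Qed.

Lemma fnorm2_eq0 n (A : 'M[C]_n) : fnorm2 A <= 0 -> A = 0.
Proof.
move=> h; apply/matrixP=> i j; rewrite mxE; apply: normc2_eq0.
by apply/eqP; rewrite eq_le normc2_ge0 (le_trans (normc2_le_fnorm2 A i j)).
Qed.

Lemma spectral_adj n (U : 'M[C]_n) (d : 'rV[R]_n) :
  mxadj (U *m rdiag d *m mxadj U) = U *m rdiag d *m mxadj U.
Proof. by rewrite !mxadjM mxadjK mxadj_rdiag mulmxA. Qed.

Lemma fnorm2_spectral n (U : 'M[C]_n) (d : 'rV[R]_n) : unitary_mx U ->
  fnorm2 (U *m rdiag d *m mxadj U) = \sum_i d 0 i ^+ 2.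
Proof.
move=> uU; apply: (@complexI R).
rewrite -mxtrace_adjM spectral_adj spectralM // mxtrace_unitary // mxtrace_rdiag.
by congr _%:C; apply: eq_bigr => i _; rewrite mxE expr2.
Qed.

Lemma sum_overlapl n (U V : 'M[C]_n) (f : 'I_n -> R) :
  unitary_mx U -> unitary_mx V ->
  \sum_i \sum_j overlap U V i j * f i = \sum_i f i.
Proof.
by move=> uU uV; apply: eq_bigr => i _; rewrite -mulr_suml overlap_row // mul1r.
Qed.

Lemma sum_overlapr n (U V : 'M[C]_n) (f : 'I_n -> R) :
  unitary_mx U -> unitary_mx V ->
  \sum_i \sum_j overlap U V i j * f j = \sum_j f j.
Proof.
move=> uU uV; rewrite exchange_big; apply: eq_bigr => j _.
by rewrite -mulr_suml overlap_col // mul1r.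
Qed.

Lemma mxtrace_sqrB (K : comNzRingType) n (A B : 'M[K]_n) :
  \tr ((A - B) *m (A - B)) = \tr (A *m A) + \tr (B *m B) - \tr (A *m B) *+ 2.
Proof.
have trB (X Y : 'M[K]_n) : \tr (X - Y) = \tr X - \tr Y by rewrite raddfB.
rewrite mulmxBl !mulmxBr !trB (mxtrace_mulC B A); ring.
Qed.

(** Expanding the square, the cross term comes from [mxtrace_spectral2]; the pure squares depend on
    one index each and are spread over the other because the weights are doubly stochastic. *)
Lemma fnorm2_spectralB n (U V : 'M[C]_n) (d e : 'rV[R]_n) :
  unitary_mx U -> unitary_mx V ->
  fnorm2 (U *m rdiag d *m mxadj U - V *m rdiag e *m mxadj V) =
  \sum_i \sum_j overlap U V i j * (d 0 i - e 0 j) ^+ 2.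
Proof.
move=> uU uV; apply: (@complexI R); rewrite -mxtrace_adjM mxadjB !spectral_adj.
rewrite mxtrace_sqrB !spectralM // mxtrace_spectral2 !mxtrace_unitary //.
have eC (x y z : R) : x%:C + y%:C - z%:C *+ 2 = (x + y - z *+ 2)%:C.
  by rewrite rmorphB rmorphD rmorphMn.
rewrite !mxtrace_rdiag eC; congr _%:C.
rewrite -(sum_overlapl _ uU uV) -(sum_overlapr _ uU uV).
rewrite -sumrMnl -big_split -sumrB; apply: eq_bigr => i _.
rewrite -sumrMnl -big_split -sumrB; apply: eq_bigr => j _ /=.
by rewrite !mxE; ring.
Qed.

(** Positivity is tested on the eigenvector [U *m delta_mx i 0]. *)
Lemma psd_spectral_ge0 n (U : 'M[C]_n) (d : 'rV[R]_n) i : unitary_mx U ->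
  psd_mx (U *m rdiag d *m mxadj U) -> 0 <= d 0 i.
Proof.
move=> uU [_ /(_ (U *m delta_mx i 0))].
rewrite mxadjM !mulmxA -(mulmxA _ (mxadj U) U) uU mulmx1.
rewrite -(mulmxA _ (mxadj U) U) uU mulmx1.
rewrite -mulmxA mxE (bigD1 i) //= big1 => [|j ji]; last first.
  by rewrite mxadjE mxE (negbTE ji) conjc0 mul0r.
rewrite addr0 mxadjE mul_diag_mx !mxE !eqxx conjc1 mul1r mulr1.
by rewrite ler0c.
Qed.

(** * Frobenius and trace norms *)

Lemma normc_sqr (z : C) : normc z ^+ 2 = normc2 z.
Proof. by case: z => a b; rewrite /= sqr_sqrtr ?addr_ge0 ?sqr_ge0. Qed.

Lemma normcr_ge0 (z : C) : 0 <= normc z.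
Proof. by case: z => a b; apply: sqrtr_ge0. Qed.

Lemma Re_le_normc (z : C) : `|complex.Re z| <= normc z.
Proof.
rewrite -(ler_pXn2r (_ : 0 < 2)%N) ?nnegrE ?normr_ge0 ?normcr_ge0 // normc_sqr.
by rewrite real_normK ?num_real // lerDl sqr_ge0.
Qed.

Lemma Im_le_normc (z : C) : `|complex.Im z| <= normc z.
Proof.
rewrite -(ler_pXn2r (_ : 0 < 2)%N) ?nnegrE ?normr_ge0 ?normcr_ge0 // normc_sqr.
by rewrite real_normK ?num_real // lerDr sqr_ge0.
Qed.

Lemma normc_le_ReIm (z : C) : normc z <= `|complex.Re z| + `|complex.Im z|.
Proof.
rewrite -(ler_pXn2r (_ : 0 < 2)%N) ?nnegrE ?addr_ge0 ?normcr_ge0 // normc_sqr.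
rewrite sqrrD !real_normK ?num_real // addrAC lerDl mulrn_wge0 //.
by rewrite mulr_ge0.
Qed.

Lemma normc_sum (I : finType) (F : I -> C) :
  normc (\sum_i F i) <= \sum_i normc (F i).
Proof.
elim/big_ind2: _ => [|x1 x2 y1 y2 h1 h2|//]; first by rewrite ComplexField.Normc.normc0.
by apply: le_trans (le_normcD _ _) _; apply: lerD.
Qed.

Definition fnorm n (A : 'M[C]_n) : R := Num.sqrt (fnorm2 A).

Lemma fnorm_ge0 n (A : 'M[C]_n) : 0 <= fnorm A.
Proof. exact: sqrtr_ge0. Qed.

Lemma fnorm_sqr n (A : 'M[C]_n) : fnorm A ^+ 2 = fnorm2 A.
Proof. by rewrite sqr_sqrtr ?fnorm2_ge0. Qed.

Lemma fnorm_le0 n (A : 'M[C]_n) : fnorm A <= 0 -> A = 0.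
Proof.
move=> h; apply: fnorm2_eq0; rewrite -fnorm_sqr.
have -> : fnorm A = 0 by apply/eqP; rewrite eq_le h fnorm_ge0.
by rewrite expr0n.
Qed.

Lemma normc_le_fnorm n (A : 'M[C]_n) i j : normc (A i j) <= fnorm A.
Proof.
rewrite -(ler_pXn2r (_ : 0 < 2)%N) ?nnegrE ?normcr_ge0 ?fnorm_ge0 //.
by rewrite normc_sqr fnorm_sqr normc2_le_fnorm2.
Qed.

Lemma sum_sqr_le (I : finType) (F : I -> R) : (forall i, 0 <= F i) ->
  \sum_i F i ^+ 2 <= (\sum_i F i) ^+ 2.
Proof.
move=> F0; rewrite [leRHS]expr2 mulr_suml; apply: ler_sum => i _.
rewrite expr2 ler_wpM2l // (bigD1 i) //= lerDl; exact: sumr_ge0.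
Qed.

Lemma fnorm_le_sum n (A : 'M[C]_n) : fnorm A <= \sum_i \sum_j normc (A i j).
Proof.
have s0 : 0 <= \sum_i \sum_j normc (A i j).
  by apply: sumr_ge0 => i _; apply: sumr_ge0 => j _; apply: normcr_ge0.
rewrite -(ler_pXn2r (_ : 0 < 2)%N) ?nnegrE ?fnorm_ge0 // fnorm_sqr.
rewrite pair_big /=; apply: le_trans (sum_sqr_le _) => [|[i j]]; last first.
  exact: normcr_ge0.
rewrite /fnorm2 pair_big /=; apply: ler_sum => -[i j] _ /=.
by rewrite normc_sqr.
Qed.

(** The vector [d] lists the squared singular values of [A]; both norms are read off from it, which
    reduces their comparison to sums of reals. *)
Lemma trnorm_sqrt_spectrum n (A : 'M[C]_n) : exists d : 'rV[R]_n,
  [/\ forall i, 0 <= d 0 i, fnorm2 A = \sum_i d 0 i &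
      trnorm A = \sum_i Num.sqrt (d 0 i)].
Proof.
have hA : mxadj (mxadj A *m A) = mxadj A *m A by rewrite mxadjM mxadjK.
have [U [d [uU AE fE]]] := mxfun_spectral Num.sqrt hA.
exists d; split.
- move=> i; apply: (psd_spectral_ge0 i uU); rewrite -AE; split=> // v.
  rewrite mulmxA -mulmxA -mxadjM mxE sumr_ge0 // => k _.
  by rewrite mxadjE mulJc ler0c normc2_ge0.
- by apply: (@complexI R); rewrite -mxtrace_adjM AE mxtrace_unitary // mxtrace_rdiag.
- rewrite /trnorm fE mxtrace_unitary // mxtrace_rdiag /=.
  by apply: eq_bigr => i _; rewrite mxE.
Qed.

Lemma trnorm_ge0 n (A : 'M[C]_n) : 0 <= trnorm A.
Proof.
have [d [_ _ ->]] := trnorm_sqrt_spectrum A.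
by apply: sumr_ge0 => i _; apply: sqrtr_ge0.
Qed.

Lemma fnorm_le_trnorm n (A : 'M[C]_n) : fnorm A <= trnorm A.
Proof.
have [d [d0 hE tE]] := trnorm_sqrt_spectrum A.
rewrite -(ler_pXn2r (_ : 0 < 2)%N) ?nnegrE ?fnorm_ge0 ?trnorm_ge0 //.
rewrite fnorm_sqr hE tE; apply: le_trans (sum_sqr_le _) => [|i]; last first.
  exact: sqrtr_ge0.
by apply: ler_sum => i _; rewrite sqr_sqrtr.
Qed.

(** Each of the n singular values is at most the Frobenius norm. *)
Lemma trnorm_le_fnorm n (A : 'M[C]_n) : trnorm A <= n%:R * fnorm A.
Proof.
have [d [d0 hE tE]] := trnorm_sqrt_spectrum A.
rewrite tE mulr_natl -[X in _ *+ X]card_ord -sumr_const; apply: ler_sum => i _.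
rewrite ler_wsqrtr // hE (bigD1 i) //= lerDl; exact: sumr_ge0.
Qed.

(** * Boundedness of linear maps *)

Lemma linear_mxE (V : lmodType C) n (f : 'M[C]_n -> V) :
  (forall a A B, f (a *: A + B) = a *: f A + f B) ->
  forall A, f A = \sum_i \sum_j A i j *: f (delta_mx i j).
Proof.
move=> lf.
have f0 : f 0 = 0.
  have := lf (-1) 0 0; rewrite !scaleN1r oppr0 addr0 => {1}->.
  by rewrite addrC subrr.
have fD A B : f (A + B) = f A + f B by have := lf 1 A B; rewrite !scale1r.
have fZ a A : f (a *: A) = a *: f A by have := lf a A 0; rewrite !addr0 f0 addr0.
move=> A; rewrite {1}(matrix_sum_delta A).
rewrite (big_morph f fD f0); apply: eq_bigr => i _.
by rewrite (big_morph f fD f0); apply: eq_bigr => j _.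
Qed.

Lemma linear_form_bounded n (f : 'M[C]_n -> C) :
  (forall a A B, f (a *: A + B) = a * f A + f B) ->
  exists2 K, 0 <= K & forall A, normc (f A) <= K * fnorm A.
Proof.
move=> lf; have fE := @linear_mxE C^o n f lf.
exists (\sum_i \sum_j normc (f (delta_mx i j))).
  by apply: sumr_ge0 => i _; apply: sumr_ge0 => j _; apply: normcr_ge0.
move=> A; rewrite fE mulr_suml; apply: le_trans (normc_sum _) _.
apply: ler_sum => i _; rewrite mulr_suml; apply: le_trans (normc_sum _) _.
apply: ler_sum => j _; rewrite ComplexField.Normc.normcM mulrC.
by rewrite ler_wpM2l ?normcr_ge0 ?normc_le_fnorm.
Qed.

Lemma linear_mx_bounded n (f : 'M[C]_n -> 'M[C]_n) :
  (forall a A B, f (a *: A + B) = a *: f A + f B) ->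
  exists2 K, 0 <= K & forall A, fnorm (f A) <= K * fnorm A.
Proof.
move=> lf.
have /choice[K KP] (ij : 'I_n * 'I_n) : exists K, 0 <= K /\
    forall A, normc (f A ij.1 ij.2) <= K * fnorm A.
  have [|K K0 KP] := @linear_form_bounded n (fun A => f A ij.1 ij.2).
    by move=> a A B; rewrite lf !mxE.
  by exists K.
exists (\sum_i \sum_j K (i, j)).
  by apply: sumr_ge0 => i _; apply: sumr_ge0 => j _; apply: (KP (i, j)).1.
move=> A; apply: le_trans (fnorm_le_sum _) _; rewrite mulr_suml.
apply: ler_sum => i _; rewrite mulr_suml; apply: ler_sum => j _.
exact: (KP (i, j)).2.
Qed.

(** * States and channels *)

Lemma density_spectral n (rho : 'M[C]_n) (f : R -> R) : density rho ->
  exists U (p : 'rV[R]_n), [/\ unitary_mx U, rho = U *m rdiag p *m mxadj U,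
    mxfun f rho = U *m rdiag (map_mx f p) *m mxadj U,
    forall i, 0 <= p 0 i <= 1 & \sum_i p 0 i = 1].
Proof.
move=> [psd tr1].
have [U [p [uU rE fE]]] := mxfun_spectral f psd.1.
have p0 i : 0 <= p 0 i by apply: (psd_spectral_ge0 i uU); rewrite -rE.
have p1 : \sum_i p 0 i = 1.
  by apply: (@complexI R); rewrite rmorph1 -tr1 rE mxtrace_unitary // mxtrace_rdiag.
exists U, p; split=> // i; rewrite p0 -p1 (bigD1 i) //= lerDl; exact: sumr_ge0.
Qed.

(** Eigenvalues lie in [0, 1], so their squares sum to at most the trace. This bound supplies the
    compactness behind the limit points. *)
Lemma density_fnorm_le1 n (rho : 'M[C]_n) : density rho -> fnorm rho <= 1.
Proof.
move=> /(density_spectral id)[U [p [uU rE _ p01 p1]]].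
rewrite -(ler_pXn2r (_ : 0 < 2)%N) ?nnegrE ?fnorm_ge0 // fnorm_sqr expr1n.
rewrite rE fnorm2_spectral // -p1; apply: ler_sum => i _.
by have /andP[p0 pl] := p01 i; rewrite expr2 ler_piMl.
Qed.

Lemma psd_congr m n (A : 'M[C]_n) (P : 'M[C]_(m, n)) :
  psd_mx A -> psd_mx (P *m A *m mxadj P).
Proof.
move=> [hA pA]; split; first by rewrite !mxadjM mxadjK hA mulmxA.
by move=> v; have := pA (mxadj P *m v); rewrite mxadjM mxadjK !mulmxA.
Qed.

(** Selecting rows and columns along [g] is congruence by the 0-1 matrix [rowsub g 1%:M], whether or
    not [g] is injective. *)
Lemma psd_mxsub m n (A : 'M[C]_n) (g : 'I_m -> 'I_n) :
  psd_mx A -> psd_mx (mxsub g g A).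
Proof.
move=> /(psd_congr (rowsub g 1%:M)).
have -> : mxadj (rowsub g 1%:M) = colsub g (1%:M : 'M[C]_n).
  apply/matrixP=> i j; rewrite mxadjE !mxE eq_sym.
  by case: eqP => _; rewrite ?conjc0 ?conjc1.
rewrite mulmx_colsub mulmx1 mul_rowsub_mx mul1mx.
by congr psd_mx; apply/matrixP=> i j; rewrite !mxE.
Qed.

(** Complete positivity at k = 1. The index types ['I_(1 * n)] and ['I_n] differ, so matrices are
    carried back and forth by reindexing. *)
Lemma channel_psd n (tau : 'M[C]_n -> 'M[C]_n) A :
  quantum_channel tau -> psd_mx A -> psd_mx (tau A).
Proof.
move=> [_ cp _] /(psd_mxsub (fun k : 'I_(1 * n) => (mxtens_unindex k).2)) /cp.
move=> /(psd_mxsub (fun a : 'I_n => mxtens_index (@ord0 0, a))).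
congr psd_mx; apply/matrixP=> i j; rewrite !mxE !mxtens_indexK.
by congr (tau _ _ _); apply/matrixP=> a b; rewrite !mxE !mxtens_indexK.
Qed.

Lemma channel_density n (tau : 'M[C]_n -> 'M[C]_n) rho :
  quantum_channel tau -> density rho -> density (tau rho).
Proof.
by move=> qc [prho trho]; split; [exact: channel_psd | case: qc => _ _ ->].
Qed.

Lemma iter_density n (tau : 'M[C]_n -> 'M[C]_n) rho m :
  quantum_channel tau -> density rho -> density (iter m tau rho).
Proof. by move=> qc drho; elim: m => //= m; apply: channel_density. Qed.

(** * Relative entropy *)

(** The library [ln] is itself 0 on nonpositive reals. *)
Lemma log0E : @log0 R = @ln R.
Proof. by apply/funext => x; rewrite /log0; case: ltP => // /ln0. Qed.

(** For a > 0, multiply the strict bound 1 + t < e^t at t = ln b - ln a by a; for a = 0 the claim is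
    -b < 0. *)
Lemma klein_scalar (a b : R) : 0 <= a -> 0 < b -> a != b ->
  a - b < a * (log0 a - log0 b).
Proof.
rewrite log0E le_eqVlt => /predU1P[<- b0 _|a0 b0 ab]; first by rewrite mul0r; lra.
have t0 : ln b - ln a != 0.
  by rewrite subr_eq0; apply: contra ab => /eqP/ln_inj ->.
have := expR_gt1Dx t0; rewrite expRB !lnK ?posrE // ltr_pdivlMr //; lra.
Qed.

(** Multiplying ln(1/x) <= 1/x - 1 by x gives -x ln x <= 1 - x. *)
Lemma norm_xlnx_le1 (x : R) : 0 <= x <= 1 -> `|x * ln x| <= 1.
Proof.
case/andP; rewrite le_eqVlt => /predU1P[<- _|x0 x1].
  by rewrite mul0r normr0.
have l0 : ln x <= 0 by apply: ln_le0.
rewrite ler0_norm; last by rewrite mulr_ge0_le0 // ltW.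
have : ln x^-1 <= x^-1 - 1.
  rewrite -[X in ln X](subrKC 1) le_ln1Dx //.
  have := invr_gt0 x; rewrite x0; lra.
rewrite lnV ?posrE // => /(ler_wpM2l (ltW x0)).
rewrite mulrBr mulfV ?gt_eqF // mulr1 mulrN; lra.
Qed.

(** With s = sqrt x one has x ln x = 2 s (s ln s), and s ln s is bounded by 1. This gives explicit
    decay at 0, where [ln] is not continuous. *)
Lemma norm_xlnx_le_sqrt (x : R) : 0 <= x <= 1 -> `|x * ln x| <= 2 * Num.sqrt x.
Proof.
case/andP; rewrite le_eqVlt => /predU1P[<- _|x0 x1].
  by rewrite mul0r normr0 sqrtr0 mulr0.
set s := Num.sqrt x; have s0 : 0 < s by rewrite sqrtr_gt0.
have xE : x = s ^+ 2 by rewrite sqr_sqrtr // ltW.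
have s1 : s <= 1 by rewrite -sqrtr1 ler_wsqrtr.
have -> : x * ln x = (2 * s) * (s * ln s) by rewrite xE lnXn //; ring.
rewrite normrM gtr0_norm ?mulr_gt0 // ler_piMr ?mulr_ge0 ?(ltW s0) //.
by rewrite norm_xlnx_le1 // (ltW s0).
Qed.

Lemma xlnx_modulus (p e : R) : 0 <= p <= 1 -> 0 < e ->
  exists2 d, 0 < d & forall q, 0 <= q <= 1 -> `|q - p| < d ->
    `|q * ln q - p * ln p| <= e.
Proof.
case/andP; rewrite le_eqVlt => /predU1P[<- _|p0 _] e0.
  (* At p = 0 this radius gives 2 sqrt q <= e. *)
  exists ((e / 2) ^+ 2); first by rewrite exprn_gt0 // divr_gt0.
  move=> q q01; rewrite subr0 mul0r subr0 => qd.
  have q0 : 0 <= q by case/andP: q01.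
  apply: le_trans (norm_xlnx_le_sqrt q01) _.
  have : Num.sqrt q <= e / 2.
    rewrite -[leRHS]ger0_norm ?divr_ge0 ?(ltW e0) // -sqrtr_sqr ler_wsqrtr //.
    by rewrite ltW // -[q]ger0_norm.
  lra.
have : {for p, continuous (fun q : R => q * ln q)}.
  by apply: continuousM; [exact: cvg_id | exact: continuous_ln].
move=> /cvgrPdist_lt /(_ e e0) /nbhs_ballP[d /= d0 H].
exists d => // q _ qd; rewrite distrC ltW //.
by apply: H; rewrite /ball /= distrC.
Qed.

(* Bounding the oscillation by a quadratic term is what lets it be summed against the overlap weights, where [\sum w_ij (p_i - q_j)^2] is the squared Frobenius distance. *)
Lemma xlnx_quadratic (p e : R) : 0 <= p <= 1 -> 0 < e ->
  exists2 K, 0 <= K & forall q, 0 <= q <= 1 ->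
    `|q * ln q - p * ln p| <= e + K * (q - p) ^+ 2.
Proof.
move=> p01 e0; have [d d0 H] := xlnx_modulus p01 e0.
(* For |q - p| >= d this factor makes the quadratic term at least 2, which bounds the difference
   outright. *)
have K0 : 0 <= 2 / d ^+ 2 by rewrite divr_ge0 // exprn_ge0 // ltW.
exists (2 / d ^+ 2) => // q q01.
have [qd|dq] := ltP `|q - p| d.
  by apply: le_trans (H q q01 qd) _; rewrite lerDl mulr_ge0 // sqr_ge0.
apply: (@le_trans _ _ 2).
  apply: le_trans (ler_normB _ _) _.
  have := norm_xlnx_le1 p01; have := norm_xlnx_le1 q01; lra.
apply: (@le_trans _ _ (2 / d ^+ 2 * (q - p) ^+ 2)); last by rewrite lerDr ltW.
rewrite mulrAC ler_pdivlMr ?exprn_gt0 // ler_pM2l //.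
by rewrite -[leRHS]real_normK ?num_real // ler_pXn2r // nnegrE ?ltW.
Qed.

(** Tr rho log rho is a sum over i alone; the row sums of the overlaps turn it into a double sum
    like the mixed term. *)
Lemma rel_entropy_spectral n (rho sigma : 'M[C]_n) :
  density rho -> density sigma -> exists U V (p q : 'rV[R]_n),
  [/\ unitary_mx U /\ unitary_mx V, rho = U *m rdiag p *m mxadj U,
    sigma = V *m rdiag q *m mxadj V,
    (forall i, 0 <= p 0 i <= 1) /\ \sum_i p 0 i = 1 /\
    (forall i, 0 <= q 0 i <= 1) /\ \sum_i q 0 i = 1 &
    rel_entropy rho sigma =
    \sum_i \sum_j overlap U V i j * (p 0 i * (log0 (p 0 i) - log0 (q 0 j)))].
Proof.
move=> /(density_spectral (@log0 R))[U [p [uU rE lrE p01 p1]]].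
move=> /(density_spectral (@log0 R))[V [q [uV sE lsE q01 q1]]].
exists U, V, p, q; split=> //.
have trB (X Y : 'M[C]_n) : \tr (X - Y) = \tr X - \tr Y by rewrite raddfB.
rewrite /rel_entropy /mxlog lrE lsE rE mulmxBr trB spectralM //.
rewrite mxtrace_unitary // mxtrace_rdiag mxtrace_spectral2 -rmorphB /=.
rewrite -(sum_overlapl _ uU uV).
rewrite -sumrB; apply: eq_bigr => i _; rewrite -sumrB; apply: eq_bigr => j _.
by rewrite !mxE; ring.
Qed.

Lemma full_rank_spectrum n (V : 'M[C]_n) (q : 'rV[R]_n) j : unitary_mx V ->
  \rank (V *m rdiag q *m mxadj V) = n -> q 0 j != 0.
Proof.
move=> uV rk; have : V *m rdiag q *m mxadj V \in unitmx.
  by rewrite -row_free_unit /row_free rk.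
rewrite !unitmx_mul => /andP[/andP[_]].
rewrite unitmxE det_diag unitfE => /prodf_neq0 /(_ j isT) + _.
by rewrite mxE; apply: contra => /eqP->.
Qed.

(** Klein's inequality: subtracting p_i - q_j, whose weighted sum is 1 - 1 = 0, makes every term
    nonnegative. A zero sum would leave no weight on pairs with p_i <> q_j, and then the Frobenius
    distance would vanish. *)
Lemma rel_entropy_gt0 n (rho sigma : 'M[C]_n) :
  density rho -> density sigma -> \rank sigma = n -> rho <> sigma ->
  0 < rel_entropy rho sigma.
Proof.
move=> drho dsigma rk ne.
have [U [V [p [q [[uU uV] rE sE [p01 [p1 [q01 q1]]] ->]]]]] :=
  rel_entropy_spectral drho dsigma.
have q0 j : 0 < q 0 j.
  have /andP[qj _] := q01 j.
  by rewrite lt_def qj andbT (@full_rank_spectrum _ V) // -sE.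
set w := overlap U V.
pose g i j := w i j * (p 0 i * (log0 (p 0 i) - log0 (q 0 j)) - (p 0 i - q 0 j)).
have -> : \sum_i \sum_j w i j * (p 0 i * (log0 (p 0 i) - log0 (q 0 j))) =
    \sum_i \sum_j g i j.
  rewrite -[RHS]addr0 -[X in _ + X](subrr (1 : R)) -{1}p1 -q1.
  rewrite -(sum_overlapl (p 0) uU uV) -(sum_overlapr (q 0) uU uV).
  rewrite -sumrB -big_split; apply: eq_bigr => i _.
  rewrite -sumrB -big_split; apply: eq_bigr => j _ /=.
  by rewrite /g /w; ring.
have g0 i j : 0 <= g i j.
  rewrite mulr_ge0 ?overlap_ge0 // subr_ge0.
  have /andP[pi _] := p01 i.
  have [->|pq] := eqVneq (p 0 i) (q 0 j); first by rewrite !subrr mulr0.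
  by rewrite ltW // klein_scalar.
rewrite lt_def; apply/andP; split; last first.
  by apply: sumr_ge0 => i _; apply: sumr_ge0.
apply/eqP; rewrite pair_big /= => /psumr_eq0P gz; apply: ne.
apply/subr0_eq/fnorm2_eq0; rewrite rE sE fnorm2_spectralB // -/w.
rewrite big1 // => i _; rewrite big1 // => j _.
have [->|pq] := eqVneq (p 0 i) (q 0 j); first by rewrite subrr expr0n mulr0.
have /eqP : g i j = 0 by apply: (gz _ (i, j)).
rewrite /g mulf_eq0 => /orP[/eqP ->|]; first by rewrite mul0r.
have /andP[pi _] := p01 i.
by rewrite subr_eq0 gt_eqF // klein_scalar.
Qed.

Lemma continuous_on_states_fnorm n (S : 'M[C]_n -> R) :
  (forall rho, density rho -> forall e : R, 0 < e -> exists2 d : R, 0 < d &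
    forall sigma, density sigma -> fnorm (sigma - rho) < d ->
      `|S sigma - S rho| < e) -> continuous_on_states S.
Proof.
move=> H rho drho e e0; have [d d0 Hd] := H rho drho e e0; exists d => // s ds sd.
by apply: Hd => //; apply: le_lt_trans sd; apply: fnorm_le_trnorm.
Qed.

Lemma rel_entropy_self n (rho : 'M[C]_n) : rel_entropy rho rho = 0.
Proof. by rewrite /rel_entropy subrr mulmx0 mxtrace0. Qed.

(** Eigenvalues of the two states are not matched up: all pairs are compared by [xlnx_quadratic] and
    averaged with the overlaps. These sum to n, whence the factor of e, and the quadratic terms are
    bounded through the squared Frobenius distance. *)
Lemma neg_entropy_quadratic n (rho : 'M[C]_n) (e : R) : density rho -> 0 < e ->
  exists2 K, 0 <= K & forall sigma, density sigma ->
    `|complex.Re (\tr (sigma *m mxlog sigma)) -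
      complex.Re (\tr (rho *m mxlog rho))| <= n%:R * e + K * fnorm (sigma - rho) ^+ 2.
Proof.
move=> /(density_spectral (@log0 R))[U [p [uU rE lrE p01 p1]]] e0.
have /choice[K KP] i : exists K, 0 <= K /\ forall q, 0 <= q <= 1 ->
    `|q * ln q - p 0 i * ln (p 0 i)| <= e + K * (q - p 0 i) ^+ 2.
  by have [K K0 KP] := xlnx_quadratic (p01 i) e0; exists K.
exists (\sum_i K i); first by apply: sumr_ge0 => i _; exact: (KP i).1.
move=> s /(density_spectral (@log0 R))[V [q [uV sE lsE q01 q1]]].
rewrite /mxlog lsE lrE fnorm_sqr sE rE fnorm2_spectralB // !spectralM //.
rewrite !mxtrace_unitary // !mxtrace_rdiag log0E /=.
rewrite -(sum_overlapl _ uV uU) -[X in _ - X](sum_overlapr _ uV uU) -sumrB.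
have -> : n%:R * e = \sum_i \sum_j overlap V U i j * e.
  by rewrite (sum_overlapl (fun=> e) uV uU) sumr_const card_ord mulr_natl.
rewrite mulr_sumr -big_split; apply: le_trans (ler_norm_sum _ _ _) _.
apply: ler_sum => i _ /=; rewrite -sumrB mulr_sumr -big_split.
apply: le_trans (ler_norm_sum _ _ _) _; apply: ler_sum => j _ /=.
rewrite !mxE -mulrBr normrM ger0_norm ?overlap_ge0 //.
rewrite [_ * (overlap _ _ _ _ * _)]mulrCA -mulrDr ler_wpM2l ?overlap_ge0 //.
apply: le_trans ((KP j).2 _ (q01 i)) _; rewrite lerD2l ler_wpM2r ?sqr_ge0 //.
by rewrite (bigD1 j) //= lerDl; apply: sumr_ge0 => k _; exact: (KP k).1.
Qed.

(** The entropy part is controlled by [neg_entropy_quadratic]; the other part is linear in rho, as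
    sigma is fixed, hence bounded. *)
Lemma rel_entropy_continuous n (sigma : 'M[C]_n) :
  continuous_on_states (fun rho => rel_entropy rho sigma).
Proof.
apply: continuous_on_states_fnorm => rho drho e e0.
pose L := mxlog sigma.
have [|K1 K10 HK1] := @linear_form_bounded n (fun A => \tr (A *m L)).
  by move=> a A B; rewrite mulmxDl -scalemxAl mxtraceD mxtraceZ.
pose e' := e / (3 * n.+1%:R).
have e'0 : 0 < e' by rewrite divr_gt0 // mulr_gt0.
have ne' : n%:R * e' <= e / 3.
  rewrite /e' invfM (mulrA e) mulrCA ler_piMr ?divr_ge0 ?(ltW e0) //.
  by rewrite ler_pdivrMr // mul1r ler_nat.
have [K2 K20 HK2] := neg_entropy_quadratic drho e'0.
(* For a distance x below [d], x < 1 gives x^2 <= x, and the other bound gives (K1 + K2 + 1) x < e /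
   3; the added 1 keeps the divisor positive. *)
pose d := Num.min 1 (e / (3 * (K1 + K2 + 1))).
have K0 : 0 < 3 * (K1 + K2 + 1) by lra.
have d0 : 0 < d by rewrite lt_min ltr01 divr_gt0.
exists d => // s ds sd; set x := fnorm (s - rho) in sd.
have x0 : 0 <= x := fnorm_ge0 _.
have /andP[x1 xe] : (x < 1) && (x < e / (3 * (K1 + K2 + 1))) by rewrite -lt_min.
have trB (X Y : 'M[C]_n) : \tr (X - Y) = \tr X - \tr Y by rewrite raddfB.
have ReB (a b : C) : complex.Re (a - b) = complex.Re a - complex.Re b.
  by case: a b => [? ?] [].
pose F (t : 'M[C]_n) : R := complex.Re (\tr (t *m mxlog t)).
pose G (t : 'M[C]_n) : R := complex.Re (\tr (t *m L)).
have E t : rel_entropy t sigma = F t - G t.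
  by rewrite /rel_entropy mulmxBr trB ReB.
have b1 : `|F s - F rho| <= n%:R * e' + K2 * x ^+ 2 by exact: HK2.
have b2 : `|G s - G rho| <= K1 * x.
  rewrite -ReB -trB -mulmxBl; apply: le_trans (Re_le_normc _) _; exact: HK1.
have b3 : K1 * x + K2 * x + x < e / 3.
  by move: xe; rewrite ltr_pdivlMr // ltr_pdivlMr //; lra.
have b4 : K2 * x ^+ 2 <= K2 * x.
  by rewrite ler_wpM2l // expr2 ler_piMl // ltW.
rewrite !E.
move: (F s) (F rho) (G s) (G rho) b1 b2 => u v u' v' b1 b2.
have -> : u - u' - (v - v') = (u - v) - (u' - v') by ring.
apply: le_lt_trans (ler_normB _ _) _.
lra.
Qed.

(** * Limit points of orbits *)

(** The image ultrafilter lives on a compact interval and so has a cluster point, which for an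
    ultrafilter is a limit. *)
Lemma ultra_bounded_cvg (T : Type) (U : set_system T) (u : T -> R) (B : R) :
  UltraFilter U -> (forall x, `|u x| <= B) -> exists l : R, u @ U --> l.
Proof.
move=> UU uB.
have UF : ProperFilter U by exact: ultra_proper.
have [|l [_ cl]] := @segment_compact R (- B) B (u @ U) _.
  apply: (@filterS _ U _ setT); last exact: filterT.
  by move=> x _ /=; rewrite in_itv /= -ler_norml.
exists l => A lA; case: (in_ultra_setVsetC (u @^-1` A) UU) => // nUA.
by have [x [nAx Ax]] := cl (~` A) A nUA lA.
Qed.

(** An ultrafilter does the work of subsequence extraction: the real and imaginary parts of all
    entries converge along the same [U], with no nested choices. *)
Lemma ultra_bounded_mx n (T : Type) (U : set_system T) (A : T -> 'M[C]_n) (B : R) :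
  UltraFilter U -> (forall x, fnorm (A x) <= B) ->
  exists L, forall e, 0 < e -> U [set x | fnorm (A x - L) < e].
Proof.
move=> UU AB; have UF : ProperFilter U by exact: ultra_proper.
have /choice[r rP] (ij : 'I_n * 'I_n) :
    exists l : R, (fun x => complex.Re (A x ij.1 ij.2)) @ U --> l.
  apply: (ultra_bounded_cvg UU) => x.
  exact: le_trans (Re_le_normc _) (le_trans (normc_le_fnorm _ _ _) (AB x)).
have /choice[s sP] (ij : 'I_n * 'I_n) :
    exists l : R, (fun x => complex.Im (A x ij.1 ij.2)) @ U --> l.
  apply: (ultra_bounded_cvg UU) => x.
  exact: le_trans (Im_le_normc _) (le_trans (normc_le_fnorm _ _ _) (AB x)).
exists (\matrix_(i, j) (r (i, j) +i* s (i, j))) => e e0.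
(* The n^2 entries contribute at most 2 e' each; the successor makes the total strictly below e and
   covers n = 0. *)
pose e' := e / (2 * (n * n).+1%:R).
have e'0 : 0 < e' by rewrite divr_gt0 // mulr_gt0.
have close : \forall x \near U, forall ij : 'I_n * 'I_n,
    `|r ij - complex.Re (A x ij.1 ij.2)| < e' /\
    `|s ij - complex.Im (A x ij.1 ij.2)| < e'.
  apply: filter_forall => ij; apply: filterI.
    by have /cvgrPdist_lt/(_ _ e'0) := rP ij.
  by have /cvgrPdist_lt/(_ _ e'0) := sP ij.
apply: filterS close => x /= close; apply: le_lt_trans (fnorm_le_sum _) _.
apply: (@le_lt_trans _ _ (\sum_(i < n) \sum_(j < n) (e' + e'))).
  apply: ler_sum => i _; apply: ler_sum => j _.
  apply: le_trans (normc_le_ReIm _) _; rewrite !mxE.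
  have [/ltW + /ltW +] := close (i, j).
  rewrite [X in X <= _ -> _]distrC [X in _ -> X <= _ -> _]distrC /=.
  by case: (A x i j) => a b /= h1 h2; apply: lerD.
rewrite !sumr_const !card_ord -mulrnA -mulr2n -mulrnA -mulr_natr.
rewrite /e' mulrAC ltr_pdivrMr ?mulr_gt0 // ltr_pM2l //.
by rewrite -natrM ltr_nat ltn_pmul2l.
Qed.

Lemma normc_conj (z : C) : normc z^*%C = normc z.
Proof. by case: z => a b; rewrite /= sqrrN. Qed.

Lemma normc_arb_small (z : C) : (forall e, 0 < e -> normc z < e) -> z = 0.
Proof.
move=> h; apply: ComplexField.Normc.eq0_normc; apply/eqP.
rewrite eq_le normcr_ge0 andbT leNgt; apply/negP => z0.
by have := h _ z0; rewrite ltxx.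
Qed.

(** Trace and quadratic forms are linear, hence bounded for the Frobenius norm, so their conditions
    pass to the limit; Hermitian symmetry is checked entry by entry. *)
Lemma density_closed n (L : 'M[C]_n) :
  (forall e : R, 0 < e -> exists2 A, density A & fnorm (A - L) < e) -> density L.
Proof.
move=> clL.
have lin (f : 'M[C]_n -> C) (e : R) : 0 < e ->
    (forall a A B, f (a *: A + B) = a * f A + f B) ->
    exists2 A, density A & normc (f A - f L) < e.
  move=> e0 lf; have [K K0 KP] := linear_form_bounded lf.
  have [|A dA Ae] := clL (e / (K + 1)).
    by rewrite divr_gt0 // ltr_wpDl.
  exists A => //; have -> : f A - f L = f (A - L).
    have := lf (-1) L A; rewrite scaleN1r mulN1r => fE.
    by rewrite [A - L]addrC fE addrC.
  apply: le_lt_trans (KP _) _; move: Ae; rewrite ltr_pdivlMr ?ltr_wpDl // => Ae.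
  have := fnorm_ge0 (A - L); nra.
have form (v : 'cV[C]_n) a (A B : 'M[C]_n) : (mxadj v *m (a *: A + B) *m v) 0 0 =
    a * (mxadj v *m A *m v) 0 0 + (mxadj v *m B *m v) 0 0.
  by rewrite mulmxDr mulmxDl -scalemxAr -scalemxAl !mxE.
split; first split.
- apply/matrixP=> i j; rewrite mxadjE; apply: subr0_eq; apply: normc_arb_small.
  move=> e e0; have [|A [[hA _] _] Ae] := clL (e / 2); first by rewrite divr_gt0.
  (* As A is Hermitian, the defect of L splits, up to conjugation, into two entries of A - L, each
     below e / 2 in modulus. *)
  have -> : (L j i)^*%C - L i j = (A i j - L i j) - (A j i - L j i)^*%C.
    by rewrite -{1}hA mxadjE rmorphB /= opprB addrACA addrA; ring.
  apply: le_lt_trans (le_normcD _ _) _; rewrite normcN normc_conj.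
  have := normc_le_fnorm (A - L) i j; have := normc_le_fnorm (A - L) j i.
  rewrite !mxE; lra.
- move=> v; set f := fun A : 'M[C]_n => (mxadj v *m A *m v) 0 0.
  (* In the order of C, 0 <= z means zero imaginary part and nonnegative real part; these pass to
     the limit separately. *)
  have fP A : density A -> complex.Im (f A) = 0 /\ 0 <= complex.Re (f A).
    by case=> -[_ /(_ v)]; rewrite -/(f A) lecE /= => /andP[/eqP ].
  have near e : 0 < e -> `|complex.Im (f L)| < e /\ - complex.Re (f L) < e.
    move=> e0; have [A /fP[iA rA] Ae] := lin f e e0 (form v).
    have := le_lt_trans (Re_le_normc _) Ae; have := le_lt_trans (Im_le_normc _) Ae.
    have -> : complex.Im (f A - f L) = - complex.Im (f L).
      by move: iA; case: (f A) (f L) => [? ?] [? ?] /= ->; rewrite add0r.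
    have -> : complex.Re (f A - f L) = complex.Re (f A) - complex.Re (f L).
      by case: (f A) (f L) => [? ?] [].
    rewrite normrN => ? /ltr_normlP[? ?]; split => //; lra.
  rewrite -/(f L) lecE /=; apply/andP; split.
    rewrite -normr_le0 leNgt; apply/negP => /near[+ _].
    by rewrite ltxx.
  rewrite leNgt; apply/negP => r0.
  have [|_] := near (- complex.Re (f L)); first by rewrite oppr_gt0.
  by rewrite ltxx.
- apply: subr0_eq; apply: normc_arb_small => e e0.
  have [|A [_ tA]] := lin (fun A => \tr A) e e0.
    by move=> a A B; rewrite mxtraceD mxtraceZ.
  by rewrite tA -normcN opprB.
Qed.

Lemma iter_linear n (tau : 'M[C]_n -> 'M[C]_n) k :
  (forall a A B, tau (a *: A + B) = a *: tau A + tau B) ->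
  forall a A B, iter k tau (a *: A + B) = a *: iter k tau A + iter k tau B.
Proof. by move=> lt a A B; elim: k => //= k ->; rewrite lt. Qed.

(** * The two implications *)

Lemma gen_lyapunov_mixing n (S : 'M[C]_n -> R) (tau : 'M[C]_n -> 'M[C]_n) rhos :
  quantum_channel tau -> density rhos -> gen_lyapunov S tau rhos -> mixing tau.
Proof.
move=> qc drhos [Sc Scvg Slim]; exists rhos; split=> // rho drho.
apply/cvgrPdist_lt => e e0; apply: contrapT => nconv.
(* The bad times, at trace distance at least e from [rhos]. Failure of convergence makes them
   unbounded, so the restricted filter is proper and an ultrafilter refines it. *)
pose P := [set m | e <= trnorm (iter m tau rho - rhos)].
have FP : ProperFilter (within P \oo).
  apply: Build_ProperFilter => // W; apply: nconv.
  have {}W : \oo [set m | P m -> False] := W; apply: filterS W => m /= Wm.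
  rewrite sub0r normrN ger0_norm ?trnorm_ge0 // ltNge; apply/negP => /Wm; exact.
have [U [UU FU]] := ultraFilterLemma FP.
have UF : ProperFilter U by exact: ultra_proper.
have ooU A : \oo A -> U A.
  by move=> ooA; apply: FU; apply: filterS ooA => m Am _.
have UP : U P by apply: FU; exact: withinT.
have [|L LP] := @ultra_bounded_mx n nat U (fun m => iter m tau rho) 1 UU.
  by move=> m; apply: density_fnorm_le1; apply: iter_density.
have dL : density L.
  apply: density_closed => d /LP /filter_ex[m md].
  by exists (iter m tau rho) => //; apply: iter_density.
(* If L were [rhos], some bad time along [U] would have trace distance below e by
   [trnorm_le_fnorm]. *)
have neL : L <> rhos.
  move=> EL; have [|m [/= Pm]] := filter_ex (filterI UP (LP (e / n.+1%:R) _)).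
    by rewrite divr_gt0.
  rewrite EL ltr_pdivlMr // ltNge => /negP; apply.
  apply: le_trans Pm _; apply: le_trans (trnorm_le_fnorm _) _.
  by rewrite mulrC ler_wpM2l ?fnorm_ge0 // ler_nat.
pose l := limn (fun m => S (iter m tau rho)).
(* At a late time m with tau^m rho near L, S(tau^(k+m) rho) is within g / 2 of both l and S(tau^k
   L), which excludes a gap g > 0. *)
have Sl k : S (iter k tau L) = l.
  apply/eqP; rewrite -subr_eq0 -normr_le0 leNgt; apply/negP => gap.
  set g := `|_| in gap.
  have g2 : 0 < g / 2 by rewrite divr_gt0.
  have [d d0 Hd] := Sc _ (iter_density k qc dL) _ g2.
  have lk := @iter_linear n tau k (let: And3 lt _ _ := qc in lt).
  have [K K0 KP] := linear_mx_bounded lk.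
  (* [n.+1] absorbs the passage from Frobenius to trace norm and [K + 1] the bound on tau^k; both
     stay positive. *)
  have Kd : 0 < d / (n.+1%:R * (K + 1)) by rewrite divr_gt0 // mulr_gt0 // ltr_wpDl.
  have /cvgrPdist_lt/(_ _ g2)[N _ HN] := Scvg rho drho.
  have [m [/= Nm Lm]] := filter_ex (filterI (ooU _ (nbhs_infty_ge N)) (LP _ Kd)).
  have h1 := HN (k + m)%N (leq_trans Nm (leq_addl _ _)).
  rewrite /= iterD -/l in h1.
  have h2 : `|S (iter k tau (iter m tau rho)) - S (iter k tau L)| < g / 2.
    apply: Hd; first exact: iter_density (iter_density m qc drho).
    have -> : iter k tau (iter m tau rho) - iter k tau L =
              iter k tau (iter m tau rho - L).
      have := lk (-1) L (iter m tau rho); rewrite !scaleN1r => fE.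
      by rewrite [_ - L]addrC fE addrC.
    apply: le_lt_trans (trnorm_le_fnorm _) _.
    apply: le_lt_trans (ler_wpM2l _ (KP _)) _ => //.
    move: Lm; rewrite ltr_pdivlMr ?mulr_gt0 ?ltr_wpDl //.
    apply: le_lt_trans; rewrite mulrA [leRHS]mulrC ler_wpM2r ?fnorm_ge0 //.
    by apply: ler_pM => //; rewrite ?ler_nat ?lerDl.
  have := ler_distD (S (iter k tau (iter m tau rho))) (S (iter k tau L)) l.
  rewrite -/g [X in _ <= X + _]distrC [X in _ <= _ + X]distrC; lra.
apply: (Slim L dL neL).
have -> : (fun m => S (iter m tau L)) = fun=> l by apply/funext.
by rewrite lim_cst //; exact/esym/(Sl 0).
Qed.

Lemma mixing_gen_lyapunov n (tau : 'M[C]_n -> 'M[C]_n) rhos :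
  quantum_channel tau -> density rhos -> tau rhos = rhos -> \rank rhos = n ->
  mixing tau -> gen_lyapunov (fun rho => rel_entropy rho rhos) tau rhos.
Proof.
move=> qc drhos fix_rhos rk [rho0 [drho0 mix]].
have iter_rhos m : iter m tau rhos = rhos by elim: m => //= m ->.
(* The orbit of [rhos] is constant, so the common limit given by mixing must be [rhos]. *)
have rho0E : rho0 = rhos.
  apply/esym/subr0_eq/fnorm_le0; apply: le_trans (fnorm_le_trnorm _) _.
  have /cvg_lim := mix _ drhos.
  rewrite (_ : (fun m => _) = fun=> trnorm (rhos - rho0)).
    by rewrite lim_cst // => -> .
  by apply/funext => m; rewrite iter_rhos.
rewrite {}rho0E in mix.
have Sc := rel_entropy_continuous rhos.
have S0 rho : density rho ->
    (fun m => rel_entropy (iter m tau rho) rhos) @ \oo --> (0 : R).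
  move=> drho; apply/cvgrPdist_lt => e e0; have [d d0 Hd] := Sc _ drhos e e0.
  have /cvgrPdist_lt/(_ d d0) := mix _ drho.
  apply: filterS => m; rewrite !sub0r !normrN ger0_norm ?trnorm_ge0 // => md.
  have := Hd _ (iter_density m qc drho) md.
  by rewrite rel_entropy_self subr0.
split=> // [rho drho|rho drho ne]; first by apply/cvg_ex; exists 0; apply: S0.
rewrite (cvg_lim _ (S0 _ drho)) //.
by apply/eqP; rewrite eq_sym gt_eqF // rel_entropy_gt0.
Qed.

End RelativeEntropy.

Theorem mainTheorem11 (R : realType) (n : nat)
  (tau : 'M[R[i]]_n -> 'M[R[i]]_n) (rhos : 'M[R[i]]_n) :
  quantum_channel tau ->
  density rhos -> tau rhos = rhos -> \rank rhos = n ->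
  (mixing tau <-> gen_lyapunov (fun rho => rel_entropy rho rhos) tau rhos).
Proof.
move=> qc drhos fix_rhos rk; split; first exact: mixing_gen_lyapunov.
exact: gen_lyapunov_mixing.
Qed.
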